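(* Let $k=a/b$, where $a,b\in\mathbf{Z}$, $b\ge 1$ and $\gcd(a,b)=1$. Then for every integer $n\ge 0$, $$\mathrm{denom}\left(p_{k}(n)\right)=b^n\prod_{p\mid b}p^{\alpha_p(n)},$$ where the product runs over the primes $p$ dividing $b$ and $$\alpha_p(n)=\mathrm{ord}_{p}(n!)=\left\lfloor \frac{n}{p}\right\rfloor +\left\lfloor \frac{n}{p^2}\right\rfloor+\cdots.$$
   Context: For a rational number $k$, the rational numbers $p_k(n)$ ($n\ge 0$) are the coefficients of the power series $\sum_{n=0}^{\infty}p_{k}(n)q^n=(q;q)_{\infty}^{k}$, where $(q;q)_\infty=\prod_{m=1}^{\infty}(1-q^m)$ and the power is defined by $(q;q)_\infty^{k}=\prod_{m=1}^\infty(1-q^m)^{k}$, each factor being expanded by the generalized binomial theorem $(1-x)^k=\sum_{i\ge 0}\binom{k}{i}(-1)^i x^i$. For a rational number $x$ written in reduced form $x=u/v$ with $u,v\in\mathbf{Z}$, $\gcd(u,v)=1$, $v\ge 1$, put $\mathrm{denom}(x)=v$. For a prime $p$ and a nonzero integer $N$, $\mathrm{ord}_p(N)$ is the integer $m$ with $p^m\mid N$ and $p^{m+1}\nmid N$. $\lfloor x\rfloor$ denotes the integer part of the real number $x$. *)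

(* Defs.v *)
From mathcomp Require Import all_boot all_order all_algebra.

Set Implicit Arguments.
Unset Strict Implicit.
Unset Printing Implicit Defensive.

Import Order.TTheory GRing.Theory Num.Theory.
Local Open Scope ring_scope.

(* A formal power series over rat is its sequence of coefficients. *)
Definition fps := nat -> rat.

Definition fps_one : fps := fun n => (n == 0%N)%:R.

Definition fps_mul (f g : fps) : fps :=
  fun n => \sum_(i < n.+1) f i * g (n - i)%N.

Definition fps_partial_prod (F : nat -> fps) (N : nat) : fps :=
  \big[fps_mul/fps_one]_(1 <= m < N.+1) F m.

(* G is the product of the F m over all m >= 1, i.e. the limit of the partial
   products for the q-adic topology: every coefficient is eventually constant
   with value that of G. *)
Definition fps_is_infprod (F : nat -> fps) (G : fps) : Prop :=
  forall n, exists N0 : nat, forall N : nat, (N0 <= N)%N ->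
    fps_partial_prod F N n = G n.

Definition gbinom (k : rat) (i : nat) : rat :=
  (\prod_(j < i) (k - j%:R)) / (i`!)%:R.

(* (1 - x) ^ k *)
Definition binom_series (k : rat) : fps := fun i => gbinom k i * (-1) ^+ i.

(* f (q ^ m), for m >= 1 *)
Definition fps_subst_pow (m : nat) (f : fps) : fps :=
  fun n => if (m %| n)%N then f (n %/ m)%N else 0.

(* (1 - q ^ m) ^ k *)
Definition qfactor (k : rat) (m : nat) : fps :=
  fps_subst_pow m (binom_series k).

(* The coefficient p_k(n) of q ^ n in (q;q)_oo ^ k. The factors with m > n are
   congruent to 1 modulo q ^ (n + 1), so the partial product up to n already has
   the right coefficient: see pcoef_infprod. *)
Definition pcoef (k : rat) (n : nat) : rat :=
  fps_partial_prod (qfactor k) n n.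

(* The series of natural numbers u 1 + u 2 + ... has sum s: convergence in nat
   means that the partial sums are eventually equal to s. *)
Definition nat_series_sum (u : nat -> nat) (s : nat) : Prop :=
  exists N0 : nat, forall N : nat, (N0 <= N)%N ->
    (\sum_(1 <= i < N.+1) u i)%N = s.

Lemma qfactor_low k m n : (n < m)%N -> qfactor k m n = fps_one n.
Proof.
rewrite /qfactor /fps_subst_pow /fps_one; case: n => [|n] ltnm.
  by rewrite dvdn0 div0n /binom_series /gbinom big_ord0 fact0 divr1 mulr1.
by rewrite gtnNdvd.
Qed.

Lemma fps_mul_one_low (f g : fps) n :
  (forall i, (i <= n)%N -> f i = fps_one i) -> fps_mul f g n = g n.
Proof.
move=> f1; rewrite /fps_mul big_ord_recl /= f1 // mul1r subn0 big1 ?addr0 //.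
by move=> i _; rewrite f1 ?mul0r // /bump leq0n add1n ltn_ord.
Qed.

Lemma qprod_high k n m N : (n < m)%N ->
  (\big[fps_mul/fps_one]_(m <= i < N) qfactor k i) n = fps_one n.
Proof.
move eqd: (N - m)%N => d; elim: d m eqd => [|d IH] m eqd ltnm.
  by rewrite big_geq // -subn_eq0 eqd.
have ltmN : (m < N)%N by rewrite -subn_gt0 eqd.
rewrite big_ltn // fps_mul_one_low; last first.
  by move=> i lein; apply/qfactor_low/(leq_ltn_trans lein).
by apply: IH; rewrite ?subnS ?eqd // ltnW.
Qed.

Lemma qprod_stable k n N m : (n <= N)%N -> (m <= n.+1)%N ->
  forall j, (j <= n)%N ->
  (\big[fps_mul/fps_one]_(m <= i < N.+1) qfactor k i) j
  = (\big[fps_mul/fps_one]_(m <= i < n.+1) qfactor k i) j.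
Proof.
move=> lenN; move eqd: (n.+1 - m)%N => d.
elim: d m eqd => [|d IH] m eqd lemn j lejn.
  have ltnm : (n < m)%N by rewrite -subn_eq0 eqd.
  by rewrite !qprod_high // (leq_ltn_trans lejn).
have ltmn : (m < n.+1)%N by rewrite -subn_gt0 eqd.
rewrite !(big_ltn ltmn) big_ltn; last exact: leq_trans ltmn _.
apply: eq_bigr => i _; rewrite IH ?subnS ?eqd //.
exact: leq_trans (leq_subr _ _) lejn.
Qed.

Lemma pcoef_infprod k : fps_is_infprod (qfactor k) (pcoef k).
Proof. by move=> n; exists n => N lenN; apply: qprod_stable. Qed.

(* Main.v *)
(** Let w(n) = b^n t(n), where t(n) is the part of n! supported on the primes
    dividing b; then w(i) w(j) divides w(i + j). The coefficient of x^n in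
    (1 - x)^(a/b), multiplied by w(n), is up to sign the product of the a - j b
    for j < n divided by the part of n! prime to b: an integer prime to b. In
    (1 - q^m)^(a/b) with m >= 2 this coefficient moves to degree m n > n, so
    there the weight leaves a factor b to spare, and so it does for the product
    of these factors over m >= 2. Multiplying by the factor m = 1 then gives
    that w(n) p_k(n) is an integer congruent modulo b to an integer prime to b,
    whence its denominator is w(n). *)

Require Import Defs.
From mathcomp Require Import all_boot all_order all_algebra.
From mathcomp Require Import ring.

Set Implicit Arguments.
Unset Strict Implicit.
Unset Printing Implicit Defensive.

Import Order.TTheory GRing.Theory Num.Theory.
Local Open Scope ring_scope.

(** * The weights and their divisibility *)

Definition weight (B n : nat) : nat := (B ^ n * n`!`_\pi(B))%N.

Lemma weight0 B : weight B 0 = 1%N.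
Proof. by rewrite /weight expn0 fact0 partn1. Qed.

Lemma weight_gt0 B n : (0 < B)%N -> (0 < weight B n)%N.
Proof. by move=> B0; rewrite muln_gt0 expn_gt0 B0 part_gt0. Qed.

(** Binomial coefficients are integers, so [i! j!] divides [(i + j)!], and this passes to the parts
    supported on the primes of [B]. *)
Lemma dvdn_weightD B i j : (weight B i * weight B j %| weight B (i + j))%N.
Proof.
rewrite /weight mulnACA -expnD dvdn_mul // -partnM ?fact_gt0 //.
apply: partn_dvd (fact_gt0 _) _.
by rewrite -(bin_fact (leq_addr j i)) addKn dvdn_mull.
Qed.

Lemma dvdn_weight_lt B d n : (d < n)%N -> (B * weight B d %| weight B n)%N.
Proof.
move=> ltdn; rewrite /weight mulnA -expnS dvdn_mul ?dvdn_exp2l //.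
apply: partn_dvd (fact_gt0 _) _.
by rewrite -(bin_fact (ltnW ltdn)) dvdn_mull // dvdn_mulr.
Qed.

Lemma weightE B n :
  weight B n = (B ^ n * \prod_(p <- primes B) p ^ logn p n`!)%N.
Proof.
(* The part of [n!] is a product over indices up to [n!] only; the bound [M] also reaches every
   prime of [B], the added exponents being 0. *)
congr (_ * _)%N; pose M := maxn n`! B.
rewrite (@widen_partn M) ?leq_maxl // -big_filter; apply: perm_big.
apply: uniq_perm; rewrite ?filter_uniq ?iota_uniq ?primes_uniq // => p.
rewrite mem_filter mem_index_iota /= andb_idr // => /[!mem_primes].
by case/and3P=> _ B0 /(dvdn_leq B0) lepB; rewrite ltnS leq_max lepB orbT.
Qed.

(** * Arithmetic progressions and generalized binomial coefficients *)

Lemma eqz_mod_prod (d : int) (I : Type) (r : seq I) (F G : I -> int) :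
  (forall i, (d %| F i - G i)%Z) ->
  (d %| \prod_(i <- r) F i - \prod_(i <- r) G i)%Z.
Proof.
move=> FG; elim/big_rec2: _ => [|i x y _ dxy]; first by rewrite subrr dvdz0.
have -> : F i * y - G i * x = F i * (y - x) + (F i - G i) * x.
  by rewrite mulrBr mulrBl addrA subrK.
by rewrite rpredD //; [exact: dvdz_mull | exact: dvdz_mulr].
Qed.

Lemma prod_subz_ffact (N n : nat) :
  \prod_(j < n) (N%:Z - j%:Z) = (N ^_ n)%:Z.
Proof.
elim: n => [|n IH]; first by rewrite big_ord0 ffactn0.
rewrite big_ord_recr /= IH ffactnSr PoszM.
case: (leqP n N) => [lenN | ltNn]; first by rewrite subzn.
(* The factor [N - n] is negative here and truncated to 0 in [ffact], but [N ^_ n] already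
   vanishes. *)
by rewrite ffact_small ?mul0r.
Qed.

(* As b is invertible modulo s, the progression is congruent to b ^+ n times a
   falling factorial of a natural number. *)
Lemma dvdz_prod_progression (a b s : int) (n : nat) :
  coprimez b s -> (s %| n`!%:Z)%Z -> (s %| \prod_(j < n) (a - j%:Z * b))%Z.
Proof.
move=> cbs sn.
have s0 : s != 0.
  by apply: contraTneq sn => ->; rewrite dvd0z eqz_nat -lt0n fact_gt0.
have [u [v uv]] := Bezoutz b s.
have {cbs}uv : u * b + v * s = 1 by rewrite uv; apply/eqP.
(* [u] inverts [b] modulo [s], so this [N] makes [N * b] congruent to [a]. *)
have [N dN] : exists N : nat, (s %| a * u - N%:Z)%Z.
  exists `|((a * u) %% s)%Z|%N.
  by rewrite gez0_abs ?modz_ge0 // -eqz_mod_dvd modz_mod.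
have dNb : (s %| a - N%:Z * b)%Z.
  have -> : a - N%:Z * b = a * v * s + (a * u - N%:Z) * b.
    by rewrite mulrBl addrA -!mulrA -mulrDr [v * s + _]addrC uv mulr1.
  by rewrite rpredD //; [exact: dvdz_mull | exact: dvdz_mulr].
rewrite -(subrK (\prod_(j < n) ((N%:Z - j%:Z) * b))
            (\prod_(j < n) (a - _ * b))) rpredD //.
  by apply: eqz_mod_prod => j; rewrite mulrBl opprB addrA subrK.
rewrite big_split /= prod_subz_ffact dvdz_mulr // (dvdz_trans sn) //.
by rewrite -bin_ffact PoszM dvdz_mull.
Qed.

Lemma coprimez_prod_progression (a b : int) (n : nat) :
  coprimez a b -> coprimez (\prod_(j < n) (a - j%:Z * b)) b.
Proof.
move=> cab; elim/big_rec: _ => [|j x _ cx]; first by rewrite coprimezE coprime1n.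
rewrite coprimezMl cx andbT /coprimez gcdzC.
by rewrite -mulNr addrC gcdzMDl gcdzC.
Qed.

Lemma weight_gbinom (a : int) (B n : nat) : (0 < B)%N -> coprimez a B ->
  exists2 M : int, coprimez M B &
    (weight B n)%:R * gbinom (a%:~R / B%:R) n = M%:~R.
Proof.
move=> B0 caB; have B0Q : B%:R != 0 :> rat by rewrite pnatr_eq0 -lt0n.
pose t := (n`!`_\pi(B))%N; pose s := (n`!`_(\pi(B)^'))%N.
have sn : (s %| n`!)%N by exact: dvdn_part.
have cBs : coprimez B s.
  by rewrite coprimezE /= (pnat_coprime (pnat_pi B0)) // part_pnat.
have /dvdzP [M ME] := dvdz_prod_progression a cBs (sn : (s%:Z %| n`!%:Z)%Z).
have s0 : s%:R != 0 :> rat by rewrite pnatr_eq0 -lt0n part_gt0.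
have t0 : t%:R != 0 :> rat by rewrite pnatr_eq0 -lt0n part_gt0.
exists M.
  (* [M] divides a product whose factors are all congruent to [a] modulo [B]. *)
  have := coprimez_prod_progression n caB.
  by rewrite ME coprimezMl => /andP [].
have prodE : M%:~R * s%:R = B%:R ^+ n * \prod_(j < n) (a%:~R / B%:R - j%:R) :> rat.
  transitivity ((M * s)%:~R : rat); first by rewrite rmorphM.
  rewrite -ME rmorph_prod -[n in _ ^+ n]card_ord -prodr_const -big_split /=.
  by apply: eq_bigr => j _; rewrite rmorphB rmorphM /=; field.
apply: (mulIf s0); rewrite prodE /weight /gbinom natrM natrX.
rewrite -[n`! in X in _ / X](partnC \pi(B) (fact_gt0 n)) natrM -/t -/s.
by field; rewrite t0 s0.
Qed.

(** * Integrality of weighted power series *)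

Lemma natr_mul_int (d w : nat) (x : rat) :
  (d %| w)%N -> d%:R * x \is a Num.int -> w%:R * x \is a Num.int.
Proof. by move=> /dvdnP [q ->] dx; rewrite natrM -mulrA rpredM ?natr_int. Qed.

Lemma weightD_int B i j (x y : rat) :
  (weight B i)%:R * x \is a Num.int -> (weight B j)%:R * y \is a Num.int ->
  (weight B (i + j))%:R * (x * y) \is a Num.int.
Proof.
move=> xi yj; apply: natr_mul_int (dvdn_weightD B i j) _.
by rewrite natrM mulrACA rpredM.
Qed.

(* The quotient by B expresses that the weighted coefficients of positive degree
   are divisible by B. *)
Definition weighted_one B (f : fps) : Prop :=
  f 0%N = 1 /\
  forall n, (0 < n)%N -> (weight B n)%:R * (f n / B%:R) \is a Num.int.

Lemma weighted_one_int B f n : (0 < B)%N ->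
  weighted_one B f -> (weight B n)%:R * f n \is a Num.int.
Proof.
move=> B0 [f0 fn]; case: n => [|n]; first by rewrite weight0 f0 mulr1 rpred1.
have := rpredM (natr_int _ B) (fn n.+1 isT).
by rewrite [_ * (_ / _)]mulrA mulrC divfK // pnatr_eq0 -lt0n.
Qed.

(** In positive degree each term of the convolution has a factor of positive degree, which absorbs
    the division by [B]; the other factor need only be integral. *)
Lemma weighted_one_mul B f g : (0 < B)%N ->
  weighted_one B f -> weighted_one B g -> weighted_one B (fps_mul f g).
Proof.
move=> B0 fB gB; split.
  by rewrite /fps_mul big_ord1 fB.1 gB.1 mulr1.
move=> n n0; rewrite /fps_mul mulr_suml mulr_sumr rpred_sum // => i _.
have lein : (i <= n)%N by rewrite -ltnS.
rewrite -{1}(subnKC lein); have [i0|i0] := posnP i.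
  rewrite i0 -mulrA; apply: weightD_int; first exact: weighted_one_int.
  by apply: gB.2; rewrite subn0.
rewrite mulrAC; apply: weightD_int; first exact: fB.2.
exact: weighted_one_int.
Qed.

Lemma weighted_one_prod B F m N : (0 < B)%N ->
  (forall i, (m <= i)%N -> weighted_one B (F i)) ->
  weighted_one B (\big[fps_mul/fps_one]_(m <= i < N) F i).
Proof.
move=> B0 FB; rewrite big_nat_cond; apply: big_ind => [||i /[!andbT]].
- by split=> // -[|n] // _; rewrite mul0r mulr0 rpred0.
- by move=> f g; exact: weighted_one_mul.
- by case/andP=> /FB.
Qed.

Lemma nat_series_sum_logn p n : prime p ->
  nat_series_sum (fun i => (n %/ p ^ i)%N) (logn p n`!).
Proof.
(* Legendre's sum can stop at [n], since [n < p ^ i] for [i > n]. *)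
move=> pp; exists n => N lenN; rewrite logn_fact //.
rewrite (@big_cat_nat _ _ _ n.+1) //= [X in (_ + X)%N]big_nat_cond.
rewrite [X in (_ + X)%N]big1 ?addn0 // => i /[!andbT] /andP [ltni _].
by rewrite divn_small // (ltn_trans ltni) // ltn_expl ?prime_gt1.
Qed.

(** * Coefficients of the infinite product *)

Lemma weight_binom_series (a : int) (B n : nat) : (0 < B)%N -> coprimez a B ->
  exists2 M : int, coprimez M B &
    (weight B n)%:R * binom_series (a%:~R / B%:R) n = M%:~R.
Proof.
move=> B0 caB; have [M cMB ME] := weight_gbinom n B0 caB.
exists (M * (-1) ^+ n).
  by rewrite coprimezMl cMB coprimezXl // coprimezE /= coprime1n.
by rewrite mulrA ME rmorphM /= rmorph_sign.
Qed.

Lemma weighted_one_qfactor (a : int) (B m : nat) :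
  (0 < B)%N -> coprimez a B -> (1 < m)%N ->
  weighted_one B (qfactor (a%:~R / B%:R) m).
Proof.
move=> B0 caB m1; split=> [|n n0]; first by rewrite qfactor_low // ltnW.
rewrite /qfactor /fps_subst_pow; case: ifP => _; last by rewrite mul0r mulr0.
apply: natr_mul_int (dvdn_weight_lt B (ltn_Pdiv m1 n0)) _.
have [M _ ME] := weight_binom_series (n %/ m) B0 caB.
set f := binom_series _ _ in ME *.
rewrite [X in X \is a _](_ : _ = M%:~R) ?intr_int // -ME natrM.
by field; rewrite pnatr_eq0 -lt0n.
Qed.

Lemma weight_pcoef (a : int) (B n : nat) : (0 < B)%N -> coprimez a B ->
  exists2 M : int, coprimez M B &
    (weight B n)%:R * pcoef (a%:~R / B%:R) n = M%:~R.
Proof.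
move=> B0 caB; rewrite /pcoef /fps_partial_prod; set k := _ / _.
have BQ0 : B%:R != 0 :> rat by rewrite pnatr_eq0 -lt0n.
(* In degree 0 the partial product is empty: there is no factor [m = 1] to split off. *)
have [-> | n0] := posnP n.
  by exists 1; rewrite ?coprimezE ?coprime1n // big_geq // weight0 mulr1.
rewrite big_ltn //; set g := \big[_/_]_(2 <= _ < _) _; rewrite /fps_mul.
have gB : weighted_one B g.
  by apply: weighted_one_prod => // i; exact: weighted_one_qfactor.
have q1 i : qfactor k 1 i = binom_series k i.
  by rewrite /qfactor /fps_subst_pow dvd1n divn1.
have [M cMB ME] := weight_binom_series n B0 caB.
(* The terms [i < n] meet [g] in positive degree, which gives the multiple [r * B]; the term [i = n]
   gives [M], as [g 0 = 1]. *)
have /intrP [r rE] : (weight B n)%:R *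
    ((\sum_(i < n) qfactor k 1 i * g (n - i)%N) / B%:R) \is a Num.int.
  rewrite mulr_suml mulr_sumr rpred_sum // => i _.
  rewrite -{1}(subnKC (ltnW (ltn_ord i))) -mulrA; apply: weightD_int.
    have [L _ LE] := weight_binom_series i B0 caB.
    by rewrite q1 LE intr_int.
  by apply: gB.2; rewrite subn_gt0.
exists (r * B + M).
  by rewrite /coprimez gcdzC gcdzMDl gcdzC.
rewrite big_ord_recr /= subnn gB.1 mulr1 q1 mulrDr ME rmorphD rmorphM /= -rE.
by rewrite -!mulrA mulVf ?mulr1.
Qed.

Lemma denq_pcoef (a : int) (B n : nat) : (0 < B)%N -> coprimez a B ->
  denq (pcoef (a%:~R / B%:R) n) = weight B n.
Proof.
move=> B0 caB; have [M cMB ME] := weight_pcoef n B0 caB.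
have wQ0 : (weight B n)%:R != 0 :> rat by rewrite pnatr_eq0 -lt0n weight_gt0.
have -> : pcoef (a%:~R / B%:R) n = M%:~R / (weight B n)%:~R.
  by rewrite -ME [RHS]mulrC mulKf.
rewrite coprimeq_den.
  by rewrite eqz_nat gtn_eqF ?weight_gt0.
rewrite coprimezE /= in cMB; rewrite /= coprimeMr coprimeXr //=.
(* If [M = 0], coprimality forces [B = 1], and the part of [n!] is trivial. *)
have [M0 | M0] := posnP `|M|%N.
  by move: cMB; rewrite M0 /coprime !gcd0n => /eqP ->; apply/eqP/part_p'nat/(pnatP _ (fact_gt0 n)).
rewrite coprime_sym (pnat_coprime (part_pnat _ _)) //.
by rewrite -coprime_pi' // coprime_sym.
Qed.

Theorem theorem1p1 (k : rat) (a b : int) (hb : 1 <= b) (hab : coprimez a b)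
    (hk : k = a%:~R / b%:~R) (n : nat) :
  denq (pcoef k n) =
    b ^+ n * \prod_(p <- primes `|b|%N) (p%:Z ^+ logn p n`!) /\
  (forall p : nat, prime p -> (p%:Z %| b)%Z ->
     nat_series_sum (fun i => (n %/ p ^ i)%N) (logn p n`!)).
Proof.
split=> [|p pp _]; last exact: nat_series_sum_logn.
case: b hb hab hk => // B B0 caB ->.
have PoszX p e : (p ^ e)%N%:Z = p%:Z ^+ e by rewrite -!natz natrX.
rewrite denq_pcoef // weightE PoszM PoszX; congr (_ * _).
by rewrite (big_morph Posz PoszM erefl); apply: eq_bigr => p _; exact: PoszX.
Qed.
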